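(* Let $n \geq 1$ and let $(s_0,\dots,s_n)$ be an attainable tuple of real numbers. Then for every real $r > 0$ and every integer $\ell$ with $1 \leq \ell \leq n$, one has $$ \sum_{m=0}^\ell \binom{\ell}{m} |s_m| r^m \geq \left(1 + |s_\ell|^{2/\ell} r^2\right)^{\ell/2}, $$ or equivalently (for every real $r>0$ and every $1 \leq \ell \leq n$) $$ \sum_{m=0}^\ell \binom{\ell}{m} |s_m| r^{\ell-m} \geq \left(|s_\ell|^{2/\ell} + r^2\right)^{\ell/2}. $$
   Context: For real numbers $y = (y_1,\dots,y_n) \in \mathbb{R}^n$ and $0 \leq k \leq n$, the elementary symmetric means are $$ s_k(y) := \frac{1}{\binom{n}{k}} \sum_{1 \leq i_1 < \dots < i_k \leq n} y_{i_1} \cdots y_{i_k}, $$ with $s_0(y) = 1$. An $(n+1)$-tuple $(s_0,\dots,s_n)$ of real numbers is called attainable if there exists $y \in \mathbb{R}^n$ (entries may be negative) with $s_k = s_k(y)$ for all $0 \leq k \leq n$; equivalently, the polynomial $\sum_{k=0}^n (-1)^k \binom{n}{k} s_k z^{n-k}$ is monic with all roots real. *)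

(* Defs.v *)
From mathcomp Require Import all_boot all_order all_algebra.
From mathcomp Require Import reals.

Set Implicit Arguments.
Unset Strict Implicit.
Unset Printing Implicit Defensive.

Import GRing.Theory Num.Theory.
Local Open Scope ring_scope.

(* Strictly increasing index sequences i_1 < ... < i_k are encoded by the
   k-element subsets of 'I_n; for k = 0 the only subset is empty, so the mean
   is 1. *)
Definition esymmean (R : realType) (n : nat) (y : 'rV[R]_n) (k : nat) : R :=
  'C(n, k)%:R^-1 *
  \sum_(A : {set 'I_n} | #|A| == k) \prod_(i in A) y ord0 i.

Definition attainable (R : realType) (n : nat) (s : n.+1.-tuple R) : Prop :=
  exists y : 'rV[R]_n, forall k : 'I_n.+1, tnth s k = esymmean y k.

(* Main.v *)
(** Differentiation keeps a real-rooted polynomial real-rooted, and up to a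
    scalar it shortens (s_0, ..., s_n) to (s_0, ..., s_(n-1)), so one may take
    n = l. Then P(z) = sum_k (-1)^k C(l,k) s_k z^(l-k) = prod_j (z - y_j). The
    triangle inequality bounds |P(ir)| = prod_j (y_j^2 + r^2)^(1/2) from above
    by the second sum, while Mahler's inequality (from AM-GM) bounds it from
    below by ((prod_j y_j^2)^(1/l) + r^2)^(l/2), where prod_j y_j^2 = s_l^2.
    The first form is the second one at 1/r, multiplied by r^l. *)

Require Import Defs.
From mathcomp Require Import all_boot all_order all_algebra.
From mathcomp Require Import reals exp.
From mathcomp Require Import complex ring.

Import Order.TTheory GRing.Theory Num.Theory.
Local Open Scope ring_scope.

(** The coefficients come from a sequence on all of [nat], so that one fixed [a] serves every degree
    when differentiation lowers [n]. *)
Definition mean_poly {R : realType} (a : nat -> R) (n : nat) : {poly R} :=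
  \sum_(k < n.+1) ((-1) ^+ k * 'C(n, k)%:R * a k) *: 'X^(n - k).

(** The list [t] carries the multiplicities, and the factorization forces [p] to be monic. *)
Definition real_rooted {R : realType} (p : {poly R}) : Prop :=
  exists t : seq R, p = \prod_(x <- t) ('X - x%:P).

(** Vieta: expand the product over the sets [J] of factors that contribute [- y_i], then group by
    the size of [J]. *)
Lemma mean_poly_esymmean {R : realType} (n : nat) (y : 'rV[R]_n) :
  mean_poly (esymmean y) n = \prod_(i < n) ('X - (y ord0 i)%:P).
Proof.
(* With the constant first, [J] in [bigA_distr] marks the constants rather than the factors ['X]. *)
under eq_bigr => i _ do rewrite addrC.
rewrite bigA_distr /=.
pose co (J : {set 'I_n}) : 'I_n.+1 := inord #|J|.
have cardE (J : {set 'I_n}) : co J = #|J| :> nat.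
  by rewrite inordK // ltnS -[leqRHS]card_ord max_card.
rewrite (partition_big co predT) //=; apply: eq_bigr => k _.
have bin_neq0 : 'C(n, k)%:R != 0 :> R.
  by rewrite pnatr_eq0 -lt0n bin_gt0 -ltnS.
rewrite /esymmean mulrA -(mulrA _ _ _^-1) divff // mulr1 mulr_sumr scaler_suml.
apply: eq_big => [J|J /eqP cJ]; first by rewrite -val_eqE /= cardE.
rewrite [RHS](bigID (mem J)) /=.
rewrite [X in _ = X * _](eq_bigr (fun i => (- y ord0 i)%:P)); last first.
  by move=> i iJ; rewrite iJ polyCN.
rewrite [X in _ = _ * X](eq_bigr (fun=> 'X)); last by move=> i /negbTE ->.
rewrite prodr_const -rmorph_prod prodrN cJ mul_polyC.
rewrite [in RHS](eq_card (B := ~: J)) => [|i]; last by rewrite inE.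
by rewrite cardsCs setCK card_ord cJ.
Qed.

(** The last term is constant and vanishes; the others match by (n+1-k) C(n+1,k) = (n+1) C(n,k). *)
Lemma deriv_mean_poly {R : realType} (a : nat -> R) (n : nat) :
  (mean_poly a n.+1)^`() = n.+1%:R *: mean_poly a n.
Proof.
rewrite /mean_poly raddf_sum big_ord_recr /= subnn expr0 linearZ /= derivC.
rewrite scaler0 addr0 scaler_sumr; apply: eq_bigr => k _.
have kn : (k <= n)%N by rewrite -ltnS.
rewrite linearZ /= derivXn subSn //= -scaler_nat !scalerA; congr (_ *: _).
have : ('C(n.+1, k) * (n - k).+1 = n.+1 * 'C(n, k))%N.
  by rewrite mulnC -subSn // -mul_bin_down.
move/(congr1 (fun m => m%:R : R)); rewrite !natrM => E.
by rewrite -!mulrA (mulrC (a k)) (mulrA 'C(_, _)%:R) E; ring.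
Qed.

Lemma logderiv_prod_XsubC {F : fieldType} (t : seq F) (z : F) :
  z \notin t ->
  (\prod_(x <- t) ('X - x%:P))^`().[z] =
    (\prod_(x <- t) (z - x)) * \sum_(x <- t) (z - x)^-1.
Proof.
elim: t => [|x t IH]; first by rewrite !big_nil derivC horner0 mulr0.
rewrite inE negb_or => /andP[zx zt]; rewrite !big_cons derivM derivXsubC mul1r.
have zx0 : z - x != 0 by rewrite subr_eq0.
rewrite hornerD hornerM IH // hornerXsubC horner_prod.
under eq_bigr => u _ do rewrite hornerXsubC.
by field.
Qed.

Lemma Im_inv {R : realType} (z : R[i]) :
  complex.Im z^-1 = - (complex.Im z / (complex.Re z ^+ 2 + complex.Im z ^+ 2)).
Proof. by case: z. Qed.

(** The imaginary part is -Im z times a nonempty sum of the positive numbers 1/|z - x|^2. *)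
Lemma Im_sum_inv_neq0 {R : realType} (t : seq R) (z : R[i]) :
  complex.Im z != 0 -> t != [::] -> \sum_(x <- t) (z - x%:C%C)^-1 != 0.
Proof.
move=> z0 t0; apply/eqP => /(congr1 (@complex.Im R)).
have ImD (u v : R[i]) : complex.Im (u + v) = complex.Im u + complex.Im v.
  by case: u v => [? ?] [].
rewrite (big_morph (@complex.Im R) ImD (erefl _)) /=.
under eq_bigr => x _ do
  rewrite Im_inv ImD (_ : complex.Im (- x%:C%C) = 0) ?addr0 ?[LHS]oppr0 //
          -mulrN.
rewrite -mulr_sumr => /eqP; rewrite mulf_eq0 (negbTE z0) /= sumrN oppr_eq0.
apply/negP; rewrite gt_eqF //.
case: t t0 => // x t _; rewrite big_cons.
have pos (u : R) : 0 < (u ^+ 2 + complex.Im z ^+ 2)^-1.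
  by rewrite invr_gt0 ltr_wpDl ?sqr_ge0 // exprn_even_gt0.
by rewrite ltr_pwDl // sumr_ge0 // => w _; rewrite ltW.
Qed.

(* A non-real root z of P' would satisfy 0 = P'(z)/P(z) = sum 1/(z - x), but
   all summands have imaginary parts of the sign opposite to that of Im z. *)
Lemma real_rooted_deriv {R : realType} (n : nat) (p q : {poly R}) :
  real_rooted p -> p^`() = n.+1%:R *: q -> q \is monic -> real_rooted q.
Proof.
move=> [t pE] dp qm.
have n0 : n.+1%:R != 0 :> R by rewrite pnatr_eq0.
have q0 : q != 0 by rewrite monic_neq0.
have t0 : t != [::].
  apply: contra_neq q0 => t0; move: dp; rewrite pE t0 big_nil derivC.
  by move/esym/eqP; rewrite scaler_eq0 (negbTE n0) => /eqP.
set toC := real_complex R.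
have [rs qE] := closed_field_poly_normal (map_poly toC q).
rewrite lead_coef_map (monicP qm) rmorph1 scale1r in qE.
have real_roots z : z \in rs -> complex.Im z = 0.
  move=> zrs; apply/eqP; apply: contraT => Imz.
  have zq : (map_poly toC q).[z] = 0.
    by apply/eqP; rewrite -/(root _ z) qE root_prod_XsubC.
  have zt : z \notin map toC t.
    by apply: contraNN Imz => /mapP[x _ ->].
  have := logderiv_prod_XsubC _ _ zt.
  have -> : \prod_(x <- map toC t) ('X - x%:P) = map_poly toC p.
    rewrite pE rmorph_prod big_map; apply: eq_bigr => x _.
    by rewrite /= map_polyXsubC.
  rewrite deriv_map dp map_polyZ hornerZ zq mulr0 => /esym/eqP.
  rewrite mulf_eq0 big_map [X in _ || (X == 0)]big_map.
  rewrite (negbTE (Im_sum_inv_neq0 _ _ Imz t0)) orbF prodf_seq_eq0.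
  case/hasP => x xt; rewrite subr_eq0 /= => /eqP zx.
  by move: zt; rewrite zx map_f.
(* All complex roots are real, so taking real parts loses nothing and the factorization descends to
   [R]. *)
exists (map (@complex.Re R) rs); apply: (map_poly_inj toC).
rewrite qE rmorph_prod big_map; apply: eq_big_seq => z /real_roots.
by rewrite /= map_polyXsubC; case: z => a b /= ->.
Qed.

Lemma coef_mean_poly {R : realType} (a : nat -> R) (n k : nat) :
  (mean_poly a n)`_k =
    if (k <= n)%N then (-1) ^+ (n - k) * 'C(n, n - k)%:R * a (n - k)%N else 0.
Proof.
rewrite /mean_poly coef_sum; case: leqP => kn.
  have kn' : (n - k < n.+1)%N by rewrite ltnS leq_subr.
  rewrite (bigD1 (Ordinal kn')) //= coefZ coefXn subKn // eqxx mulr1.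
  rewrite big1 ?addr0 // => i; rewrite -val_eqE /= => ik.
  rewrite coefZ coefXn; case: eqP => [E|]; last by rewrite mulr0.
  by move: ik; rewrite E subKn ?eqxx // -ltnS.
rewrite big1 // => i _; rewrite coefZ coefXn gtn_eqF ?mulr0 //.
by rewrite (leq_ltn_trans (leq_subr _ _)).
Qed.

Lemma size_mean_poly {R : realType} (a : nat -> R) (n : nat) :
  a 0 = 1 -> size (mean_poly a n) = n.+1.
Proof.
move=> a0; apply/eqP; rewrite eqn_leq; apply/andP; split.
  by apply/leq_sizeP => k nk; rewrite coef_mean_poly leqNgt nk.
rewrite ltnNge; apply/negP => /leq_sizeP /(_ n (leqnn n)) /eqP.
by rewrite coef_mean_poly leqnn subnn bin0 a0 !mulr1 oner_eq0.
Qed.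

Lemma mean_poly_monic {R : realType} (a : nat -> R) (n : nat) :
  a 0 = 1 -> mean_poly a n \is monic.
Proof.
move=> a0; rewrite monicE lead_coefE size_mean_poly //= coef_mean_poly.
by rewrite leqnn subnn bin0 a0 !mulr1.
Qed.

Lemma real_rooted_mean_poly_le {R : realType} (a : nat -> R) (n l : nat) :
  a 0 = 1 -> (l <= n)%N ->
  real_rooted (mean_poly a n) -> real_rooted (mean_poly a l).
Proof.
move=> a0 /subnK <-; elim: (n - l)%N => // k IH rr; apply: IH.
by apply: (real_rooted_deriv (k + l) _ _ rr);
  rewrite ?deriv_mean_poly ?mean_poly_monic.
Qed.

(** AM-GM is applied to the ratios u_i/(u_i+c) and to c/(u_i+c); the two arithmetic means add up to
    1. *)
Lemma mahler_prodD {R : realType} (l : nat) (u : 'I_l -> R) (g c : R) :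
  (0 < l)%N -> (forall i, 0 <= u i) -> 0 <= g -> 0 < c ->
  g ^+ l = \prod_i u i -> (g + c) ^+ l <= \prod_i (u i + c).
Proof.
move=> l0 u0 g0 c0 gE.
have uc0 i : 0 < u i + c by rewrite ltr_wpDl.
set P := \prod_i (u i + c).
have P0 : 0 < P by apply: prodr_gt0.
(* [m] is the geometric mean of the u_i + c, so h/m below is that of the v_i/(u_i+c). *)
have [m m0 mE] : exists2 m : R, 0 < m & m ^+ l = P.
  exists (P `^ l%:R^-1); first by rewrite powR_gt0.
  rewrite -powR_mulrn ?powR_ge0 // -powRrM mulVf ?powRr1 ?ltW //.
  by rewrite pnatr_eq0 -lt0n.
have lR0 : 0 < l%:R :> R by rewrite ltr0n.
have AGM (v : 'I_l -> R) (h : R) : (forall i, 0 <= v i) -> 0 <= h ->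
    h ^+ l = \prod_i v i -> h / m <= (\sum_i v i / (u i + c)) / l%:R.
  move=> v0 h0 hE.
  have w0 i : 0 <= v i / (u i + c) by rewrite divr_ge0 // ltW.
  have := leif_AGM (A := 'I_l) (fun i _ => w0 i).
  rewrite card_ord => /leifP.
  have -> : \prod_(i in 'I_l) (v i / (u i + c)) = (h / m) ^+ l.
    by rewrite prodf_div -hE expr_div_n mE.
  move=> H.
  have {H} : (h / m) ^+ l <= ((\sum_i v i / (u i + c)) / l%:R) ^+ l.
    by move: H; case: ifP => _ => [/eqP->|/ltW].
  by rewrite ler_pXn2r // nnegrE divr_ge0 ?sumr_ge0 // ltW.
have H1 := AGM u g u0 g0 gE.
have H2 : c / m <= (\sum_(i < l) c / (u i + c)) / l%:R.
  by apply: (AGM (fun=> c)) => [_||]; rewrite ?ltW // prodr_const card_ord.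
have : (g + c) / m <= 1.
  rewrite mulrDl; apply: (le_trans (lerD H1 H2)).
  rewrite -mulrDl -big_split /= (eq_bigr (fun=> 1)) => [|i _].
    by rewrite sumr_const card_ord divff // gt_eqF.
  by rewrite -mulrDl divff // gt_eqF.
rewrite ler_pdivrMr // mul1r => gm.
by rewrite -mE lerXn2r // nnegrE ltW // ltr_wpDl.
Qed.

Lemma sqr_normC_prod_sub_i {R : realType} (t : seq R) (r : R) :
  `|\prod_(x <- t) (Complex 0 r - x%:C%C)| ^+ 2 =
    (\prod_(x <- t) (x ^+ 2 + r ^+ 2))%:C%C.
Proof.
rewrite normr_prod -prodrXl rmorph_prod; apply: eq_bigr => x _.
rewrite -add_Re2_Im2 /=; congr (_%:C%C).
by rewrite add0r sqrrN oppr0 addr0.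
Qed.

(** The second inequality, squared: [g] stands for |a_l|^(2/l), and only natural exponents occur. *)
Lemma sqr_sum_ge {R : realType} (a : nat -> R) (l : nat) (g r : R) :
  (0 < l)%N -> a 0 = 1 -> real_rooted (mean_poly a l) -> 0 < r -> 0 <= g ->
  g ^+ l = `|a l| ^+ 2 ->
  (g + r ^+ 2) ^+ l <=
    (\sum_(m < l.+1) 'C(l, m)%:R * `|a m| * r ^+ (l - m)%N) ^+ 2.
Proof.
move=> l0 a0 [t pE] r0 g0 gE.
set S := \sum_(m < _) _.
have S0 : 0 <= S.
  by apply: sumr_ge0 => m _; rewrite !mulr_ge0 ?exprn_ge0 ?ler0n // ltW.
have st : size t = l.
  by have := size_mean_poly _ l a0; rewrite pE size_prod_XsubC => -[].
have : \prod_(x <- t) (x ^+ 2 + r ^+ 2) <= S ^+ 2.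
  (* The norm of [R[i]] takes its values in [R[i]], so the triangle inequality for P(ir) is carried
     out there. *)
  rewrite -lecR -sqr_normC_prod_sub_i rmorphXn /=.
  rewrite lerXn2r ?nnegrE ?normr_ge0 ?ler0c //.
  have -> : \prod_(x <- t) (Complex 0 r - x%:C%C) =
      (map_poly (real_complex R) (mean_poly a l)).[Complex 0 r].
    rewrite pE rmorph_prod horner_prod; apply: eq_bigr => x _ /=.
    by rewrite map_polyXsubC hornerXsubC.
  rewrite rmorph_sum horner_sum rmorph_sum /=.
  apply: (le_trans (ler_norm_sum _ _ _)); apply: ler_sum => k _.
  rewrite map_polyZ map_polyXn hornerZ hornerXn normrM normrX.
  have -> : `|Complex 0 r| = r%:C%C.
    by rewrite normc_def /= expr0n add0r sqrtr_sqr gtr0_norm.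
  rewrite -rmorphXn normc_def /= expr0n addr0 sqrtr_sqr -rmorphM lecR.
  by rewrite !normrM normrX normrN1 expr1n mul1r normr_nat.
apply: le_trans; subst l.
rewrite (big_nth 0) big_mkord; apply: mahler_prodD; rewrite ?exprn_gt0 //.
  by move=> i; rewrite sqr_ge0.
(* Both sides are |P(0)|, read off the constant coefficient and off the roots. *)
have aE : `|a (size t)| = `|\prod_(i < size t) t`_i|.
  rewrite -(big_mkord xpredT (nth 0 t)) -(big_nth 0 xpredT id).
  have := coef_mean_poly a (size t) 0.
  rewrite subn0 binn mulr1 pE -horner_coef0 horner_prod => /(congr1 Num.norm).
  rewrite normrM normrX normrN1 expr1n mul1r => <-; rewrite !normr_prod.
  by apply: eq_bigr => x _; rewrite hornerXsubC add0r normrN.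
by rewrite gE aE real_normK ?num_real // prodrXl.
Qed.

Lemma sqr_expr_powR_half {R : realType} (x S : R) (l : nat) :
  0 <= x -> 0 <= S -> x ^+ l <= S ^+ 2 -> x `^ (l%:R / 2) <= S.
Proof.
move=> x0 S0 H; rewrite powRrM powR12_sqrt ?powR_ge0 // powR_mulrn //.
by rewrite -[leRHS]ger0_norm // -sqrtr_sqr ler_sqrt // sqr_ge0.
Qed.

Theorem theorem1p3 (R : realType) (n : nat) (hn : (1 <= n)%N)
    (s : n.+1.-tuple R) (hs : attainable s) (r : R) (hr : 0 < r)
    (l : nat) (hl : (1 <= l <= n)%N) :
  (1 + `|s`_l| `^ (2 / l%:R) * r ^+ 2) `^ (l%:R / 2)
    <= \sum_(0 <= m < l.+1) 'C(l, m)%:R * `|s`_m| * r ^+ m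
  /\
  (`|s`_l| `^ (2 / l%:R) + r ^+ 2) `^ (l%:R / 2)
    <= \sum_(0 <= m < l.+1) 'C(l, m)%:R * `|s`_m| * r ^+ (l - m)%N.
Proof.
case/andP: hl => l0 ln; case: hs => y sy.
have sE k : (k <= n)%N -> s`_k = esymmean y k.
  by rewrite -ltnS => kn; rewrite -(sy (Ordinal kn)) (tnth_nth 0).
have s0 : s`_0 = 1.
  rewrite sE // /esymmean bin0 invr1 mul1r.
  rewrite (eq_bigl (pred1 set0)) => [|A]; last by rewrite /= cards_eq0.
  by rewrite big_pred1_eq big_set0.
have rr : real_rooted (mean_poly (nth 0 s) l).
  apply: (real_rooted_mean_poly_le _ _ _ s0 ln).
  exists [seq y ord0 i | i : 'I_n]; rewrite big_image /= -mean_poly_esymmean.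
  by apply: eq_bigr => k _; rewrite sE // -ltnS.
set g := `|s`_l| `^ (2 / l%:R).
have g0 : 0 <= g by exact: powR_ge0.
have gE : g ^+ l = `|s`_l| ^+ 2.
  rewrite -powR_mulrn // -powRrM mulfVK ?powR_mulrn //.
  by rewrite pnatr_eq0 -lt0n.
(* The radius stays free: it will be [r] for the second inequality and [r^-1] for the first. *)
have key := sqr_sum_ge _ _ _ _ l0 s0 rr _ g0 gE.
have term0 (e : nat -> nat) :
    0 <= \sum_(m < l.+1) 'C(l, m)%:R * `|s`_m| * r ^+ e m.
  by apply: sumr_ge0 => m _; rewrite !mulr_ge0 ?exprn_ge0 ?ler0n // ltW.
rewrite !big_mkord; split; apply: sqr_expr_powR_half;
  rewrite ?(term0 id) ?(term0 (subn l)) ?addr_ge0 ?(mulr_ge0 g0 (sqr_ge0 r))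
    ?sqr_ge0 ?key //.
have := key r^-1; rewrite invr_gt0 => /(_ hr).
(* The inequality at [r^-1] is squared, so the factor r^l enters as r^(2l). *)
rewrite -(ler_pM2r (exprn_gt0 (l * 2) hr)).
rewrite [in X in X <= _]mulnC !exprM -!exprMn mulrDl -exprMn mulVf ?gt_eqF //.
rewrite expr1n addrC mulr_suml => /le_trans; apply.
(* What remains is an equality, termwise r^-(l-m) r^l = r^m. *)
rewrite le_eqVlt; apply/orP; left; apply/eqP; congr (_ ^+ 2).
apply: eq_bigr => m _; rewrite -[LHS]mulrA; congr (_ * _).
have -> : r ^+ l = r ^+ (l - m) * r ^+ m by rewrite -exprD subnK // -ltnS.
by rewrite mulrA -exprMn mulVf ?gt_eqF // expr1n mul1r.
Qed.
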